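(* Let $n\in\mathbb{N}$, $n\ge 1$, and let $f:\mathbb{R}\to\mathbb{R}$ be an $n$-monomial function. Then the graph $G(f)=\{(x,f(x)):x\in\mathbb{R}\}\subseteq\mathbb{R}^2$ is either connected or totally disconnected. Furthermore, for every $n\in\mathbb{N}$, $n\ge1$, there exist a discontinuous $n$-monomial function $f:\mathbb{R}\to\mathbb{R}$ whose graph is connected and a discontinuous $n$-monomial function $g:\mathbb{R}\to\mathbb{R}$ whose graph is totally disconnected.
   Context: For $h\in\mathbb{R}$, $\Delta_h f(x)=f(x+h)-f(x)$ and $\Delta_h^{n}=\Delta_h\circ\Delta_h^{n-1}$. A function $f:\mathbb{R}\to\mathbb{R}$ is an $n$-monomial function if $\frac{1}{n!}\Delta_h^n f(x)=f(h)$ for all $x,h\in\mathbb{R}$ (equivalently, $f(x)=F(x,\dots,x)$ for some symmetric $n$-additive $F:\mathbb{R}^n\to\mathbb{R}$). A subset of $\mathbb{R}^2$ is totally disconnected if all its connected components are singletons. $\mathbb{R}^2$ carries the Euclidean topology and $G(f)$ the subspace topology. *)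

(* Defs.v *)
From Stdlib Require Import Reals Arith.
Open Scope R_scope.

Definition Delta (h : R) (f : R -> R) : R -> R := fun x => f (x + h) - f x.

Fixpoint Delta_n (h : R) (n : nat) (f : R -> R) : R -> R :=
  match n with
  | O => f
  | S m => Delta h (Delta_n h m f)
  end.

Definition monomial (n : nat) (f : R -> R) : Prop :=
  forall x h : R, / INR (Factorial.fact n) * Delta_n h n f x = f h.

Definition R2 : Type := (R * R)%type.
Definition dist2 (p q : R2) : R :=
  sqrt ((fst p - fst q) ^ 2 + (snd p - snd q) ^ 2).

Definition open2 (U : R2 -> Prop) : Prop :=
  forall p, U p -> exists eps, 0 < eps /\ forall q, dist2 p q < eps -> U q.

Definition connected2 (S : R2 -> Prop) : Prop :=
  ~ exists U V : R2 -> Prop,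
      open2 U /\ open2 V /\
      (forall p, S p -> U p \/ V p) /\
      (exists p, S p /\ U p) /\
      (exists p, S p /\ V p) /\
      (forall p, S p -> U p -> V p -> False).

Definition component2 (S : R2 -> Prop) (p : R2) : R2 -> Prop :=
  fun q => exists T : R2 -> Prop,
      (forall r, T r -> S r) /\ connected2 T /\ T p /\ T q.

Definition totally_disconnected2 (S : R2 -> Prop) : Prop :=
  forall p, S p -> forall q, component2 S p q -> q = p.

Definition graph (f : R -> R) : R2 -> Prop := fun p => snd p = f (fst p).

(* Main.v *)
(** A monomial function satisfies [f (r x) = r^n f x] for rational [r], so the
    dilations [(x, y) |-> (r x, r^n y)] preserve its graph.  If some connected
    subset of the graph has two points, then the graph over a whole interval is
    connected; its dilations cover both open half-lines by overlapping pieces,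
    and they accumulate at the origin, so the whole graph is connected.

    Powers of additive functions are monomial.  The [n]-th power of an additive
    [phi : R -> Q] with [phi 1 = 1] has a disconnected, hence totally
    disconnected, graph.  For the connected example, open sets [U], [V]
    separating the graph of [phi] would leave, over every point of some interval,
    a point [(x, y)] lying in neither or in both.  There are as many pairs [(U, V)]
    as binary sequences [a], and the reals [e_a = sum 1/c!], over the codes [c] of
    the prefixes of [a], are linearly independent over [Q].  A rational multiple
    of [e_a] lies in the interval belonging to [a], so one additive [phi] can be
    prescribed to pass through such a point for all pairs simultaneously. *)
From Stdlib Require Import Reals Lra Lia ZArith Arith List Cantor.
From Stdlib Require Import Classical ClassicalEpsilon FunctionalExtensionality.
From mathcomp Require boolp classical_sets.
Require Import Defs.
Open Scope R_scope.

(** * Homogeneity of monomial functions *)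

(* [T] stands for the operator with [Delta h' = T o Delta h]: a sum of shifts
   when [h'] is a multiple of [h], minus a shift when [h' = - h]. *)
Lemma monomial_dilate (n : nat) (f : R -> R) (h h' c : R)
    (T : (R -> R) -> R -> R) :
  monomial n f ->
  (forall g, Delta h' g = T (Delta h g)) ->
  (forall g, Delta h (T g) = T (Delta h g)) ->
  (forall C, T (fun _ => C) = fun _ => c * C) ->
  f h' = c ^ n * f h.
Proof.
  intros Hf Hh' Hcomm Hconst.
  assert (comm : forall m g, Delta h (Nat.iter m T g) = Nat.iter m T (Delta h g)).
  { intros m g; induction m as [|m IH]; simpl; [reflexivity|].
    now rewrite Hcomm, IH. }
  assert (iter_Delta : forall m, Delta_n h' m f = Nat.iter m T (Delta_n h m f)).
  { intros m; induction m as [|m IH]; [reflexivity|].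
    cbn [Delta_n Nat.iter nat_rect]. rewrite IH, Hh', comm. reflexivity. }
  assert (iter_const : forall m C, Nat.iter m T (fun _ => C) = fun _ => c ^ m * C).
  { intros m C; induction m as [|m IH]; simpl.
    - apply functional_extensionality; intros; ring.
    - rewrite IH, Hconst. apply functional_extensionality; intros; ring. }
  pose proof (INR_fact_neq_0 n) as Hn.
  (* The [n]-th difference with step [h] is the constant [n! f h], on which each of the [n]
     applications of [T] acts as multiplication by [c]. *)
  assert (HD : Delta_n h n f = fun _ => INR (fact n) * f h).
  { apply functional_extensionality; intros x.
    rewrite <- (Hf x h). field. exact Hn. }
  rewrite <- (Hf 0 h'), iter_Delta, HD, iter_const. field. exact Hn.
Qed.

(** With [E] the shift by [h], this is the operator [1 + E + ... + E^(k-1)], the cofactor of [E - 1]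
    in [E^k - 1]. *)
Fixpoint shift_sum (h : R) (k : nat) (g : R -> R) (x : R) : R :=
  match k with
  | O => 0
  | S j => shift_sum h j g x + g (x + INR j * h)
  end.

Lemma Delta_multiple (h : R) (k : nat) (g : R -> R) :
  Delta (INR k * h) g = shift_sum h k (Delta h g).
Proof.
  apply functional_extensionality; intros x.
  induction k as [|k IH].
  - unfold Delta; simpl. replace (x + 0 * h) with x by ring. ring.
  - cbn [shift_sum]. rewrite <- IH. unfold Delta. rewrite S_INR.
    replace (x + (INR k + 1) * h) with (x + INR k * h + h) by ring. ring.
Qed.

Lemma Delta_shift_sum (h : R) (k : nat) (g : R -> R) :
  Delta h (shift_sum h k g) = shift_sum h k (Delta h g).
Proof.
  apply functional_extensionality; intros x.
  induction k as [|k IH].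
  - unfold Delta; simpl; ring.
  - cbn [shift_sum]. rewrite <- IH. unfold Delta. cbn [shift_sum].
    replace (x + h + INR k * h) with (x + INR k * h + h) by ring. ring.
Qed.

Lemma shift_sum_const (h C : R) (k : nat) :
  shift_sum h k (fun _ => C) = fun _ => INR k * C.
Proof.
  apply functional_extensionality; intros x.
  induction k as [|k IH]; [simpl; ring|].
  cbn [shift_sum]. rewrite IH, S_INR. ring.
Qed.

Lemma monomial_INR (n : nat) (f : R -> R) (k : nat) (x : R) :
  monomial n f -> f (INR k * x) = INR k ^ n * f x.
Proof.
  intros Hf.
  apply (monomial_dilate n f x _ _ (shift_sum x k) Hf).
  - apply Delta_multiple.
  - apply Delta_shift_sum.
  - intros C; apply shift_sum_const.
Qed.

(** With [E] the shift by [x], the identity [E^-1 - 1 = - E^-1 (E - 1)] gives [T], which multiplies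
    constants by [-1]. *)
Lemma monomial_opp (n : nat) (f : R -> R) (x : R) :
  monomial n f -> f (- x) = (-1) ^ n * f x.
Proof.
  intros Hf.
  apply (monomial_dilate n f x _ _ (fun g y => - g (y - x)) Hf);
    intros; apply functional_extensionality; intros y; unfold Delta.
  - replace (y - x + x) with y by ring.
    replace (y + - x) with (y - x) by ring. ring.
  - replace (y - x + x) with (y + x - x) by ring. ring.
  - ring.
Qed.

Lemma monomial_IZR (n : nat) (f : R -> R) (p : Z) (x : R) :
  monomial n f -> f (IZR p * x) = IZR p ^ n * f x.
Proof.
  intros Hf. destruct (Z_le_gt_dec 0 p) as [Hp|Hp].
  - rewrite <- (Z2Nat.id p Hp), <- INR_IZR_INZ. now apply monomial_INR.
  - replace (IZR p) with (-1 * INR (Z.to_nat (- p))).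
    2:{ rewrite INR_IZR_INZ, Z2Nat.id by lia. rewrite opp_IZR. ring. }
    set (k := Z.to_nat (- p)).
    replace (-1 * INR k * x) with (- (INR k * x)) by ring.
    rewrite (monomial_opp n f _ Hf), (monomial_INR n f _ _ Hf), Rpow_mult_distr.
    ring.
Qed.

Definition rational (r : R) : Prop :=
  exists p q : Z, q <> 0%Z /\ r = IZR p / IZR q.

Lemma monomial_rational (n : nat) (f : R -> R) (r x : R) :
  monomial n f -> rational r -> f (r * x) = r ^ n * f x.
Proof.
  intros Hf (p & q & Hq & ->).
  apply not_0_IZR in Hq.
  apply (Rmult_eq_reg_l (IZR q ^ n)); [|now apply pow_nonzero].
  rewrite <- (monomial_IZR n f q _ Hf).
  replace (IZR q * (IZR p / IZR q * x)) with (IZR p * x) by now field.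
  rewrite (monomial_IZR n f p _ Hf), <- Rmult_assoc, <- Rpow_mult_distr.
  do 2 f_equal. now field.
Qed.

Lemma monomial_0 (n : nat) (f : R -> R) :
  (1 <= n)%nat -> monomial n f -> f 0 = 0.
Proof.
  (* The dilation by [0] gives [f 0 = 0^n f 0], and [0^n = 0] for [n >= 1]. *)
  intros Hn Hf. generalize (monomial_INR n f 0 0 Hf).
  destruct n; [lia|]. simpl. rewrite Rmult_0_l. lra.
Qed.

(** * Rational numbers *)

Lemma rational_IZR (p : Z) : rational (IZR p).
Proof. exists p, 1%Z. split; [lia|]. field. Qed.

Lemma rational_plus (r s : R) : rational r -> rational s -> rational (r + s).
Proof.
  intros (p & q & Hq & ->) (p' & q' & Hq' & ->).
  exists (p * q' + p' * q)%Z, (q * q')%Z. split; [nia|].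
  rewrite plus_IZR, !mult_IZR. apply not_0_IZR in Hq, Hq'. now field.
Qed.

Lemma rational_mult (r s : R) : rational r -> rational s -> rational (r * s).
Proof.
  intros (p & q & Hq & ->) (p' & q' & Hq' & ->).
  exists (p * p')%Z, (q * q')%Z. split; [nia|].
  rewrite !mult_IZR. apply not_0_IZR in Hq, Hq'. now field.
Qed.

Lemma rational_inv (r : R) : r <> 0 -> rational r -> rational (/ r).
Proof.
  intros Hr (p & q & Hq & ->).
  assert (Hp : p <> 0%Z) by (intros ->; apply Hr; unfold Rdiv; ring).
  exists q, p. split; [exact Hp|].
  apply not_0_IZR in Hq, Hp. now field.
Qed.

Lemma rational_pow (r : R) (n : nat) : rational r -> rational (r ^ n).
Proof.
  intros Hr. induction n as [|n IH]; [apply (rational_IZR 1)|].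
  now apply rational_mult.
Qed.

Lemma exists_large_nat (x : R) : exists N : nat, x < INR (S N).
Proof.
  destruct (archimed x) as [H _].
  exists (Z.to_nat (up x)). rewrite S_INR, INR_IZR_INZ.
  destruct (Z_le_gt_dec 0 (up x)) as [H0|H0].
  - rewrite Z2Nat.id by lia. lra.
  - assert (up x <= 0)%Z by lia. apply IZR_le in H1.
    assert (0 <= Z.of_nat (Z.to_nat (up x)))%Z by lia. apply IZR_le in H2. lra.
Qed.

Lemma rational_dense (a b : R) : a < b -> exists r, rational r /\ a < r < b.
Proof.
  intros Hab. destruct (exists_large_nat (/ (b - a))) as [N HN].
  assert (HS : 0 < INR (S N)) by (apply lt_0_INR; lia).
  assert (H1 : 1 < INR (S N) * (b - a)).
  { apply (Rmult_lt_compat_r (b - a)) in HN; [|lra].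
    rewrite Rinv_l in HN; lra. }
  destruct (archimed (a * INR (S N))) as [Hu1 Hu2].
  (* The first fraction of denominator [N + 1] beyond [a]; it exceeds [a] by at most
     [1 / (N + 1) < b - a]. *)
  exists (IZR (up (a * INR (S N))) / INR (S N)). split.
  - exists (up (a * INR (S N))), (Z.of_nat (S N)). split; [lia|].
    now rewrite <- INR_IZR_INZ.
  - split.
    + apply (Rmult_lt_reg_r (INR (S N))); [exact HS|].
      unfold Rdiv. rewrite Rmult_assoc, Rinv_l; lra.
    + apply (Rmult_lt_reg_r (INR (S N))); [exact HS|].
      unfold Rdiv. rewrite Rmult_assoc, Rinv_l; lra.
Qed.

Lemma nonzero_rational_dense (a b : R) :
  a < b -> exists r, rational r /\ r <> 0 /\ a < r < b.
Proof.
  intros Hab. destruct (Rlt_dec 0 b) as [Hb|Hb].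
  - destruct (rational_dense (Rmax a 0) b) as (r & Hr & H1 & H2).
    { now apply Rmax_lub_lt. }
    pose proof (Rmax_l a 0). pose proof (Rmax_r a 0).
    exists r. repeat split; auto; lra.
  - destruct (rational_dense a b Hab) as (r & Hr & H).
    exists r. repeat split; auto; lra.
Qed.

Lemma rational_multiple_dense (z a b : R) :
  z <> 0 -> a < b -> exists r, rational r /\ r <> 0 /\ a < r * z < b.
Proof.
  intros Hz Hab.
  destruct (nonzero_rational_dense (Rmin (a / z) (b / z)) (Rmax (a / z) (b / z)))
    as (r & Hr & Hr0 & H1 & H2).
  { assert (a / z <> b / z).
    { intros E. apply (f_equal (fun t => t * z)) in E.
      unfold Rdiv in E. rewrite !Rmult_assoc, Rinv_l in E; lra. }
    unfold Rmin, Rmax. destruct (Rle_dec (a / z) (b / z)); lra. }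
  exists r. split; [exact Hr|]. split; [exact Hr0|].
  set (u := a / z) in *. set (v := b / z) in *.
  assert (Ha : a = u * z) by (unfold u; now field).
  assert (Hb : b = v * z) by (unfold v; now field).
  rewrite Ha, Hb in *. clear Ha Hb.
  unfold Rmin, Rmax in *. destruct (Rle_dec u v); destruct (Rdichotomy z 0 Hz); nra.
Qed.

(** Infinite descent: [p] and then [q] are even, and their halves satisfy the same equation. *)
Lemma sqr_eq_double (p q : nat) : (p * p = 2 * (q * q))%nat -> q = 0%nat.
Proof.
  revert p. induction q as [q IH] using lt_wf_ind. intros p H.
  destruct (Nat.eq_dec q 0) as [|Hq]; [assumption|].
  assert (Hp : exists p', p = (2 * p')%nat).
  { destruct (Nat.Even_or_Odd p) as [[p' E]|[p' E]]; [now exists p'|]. nia. }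
  destruct Hp as [p' ->].
  assert (Hq' : exists q', q = (2 * q')%nat).
  { destruct (Nat.Even_or_Odd q) as [[q' E]|[q' E]]; [now exists q'|]. nia. }
  destruct Hq' as [q' ->].
  assert (q' = 0)%nat by (apply (IH q' ltac:(lia) p'); nia). lia.
Qed.

Lemma irrational_between_0_1 : exists s, ~ rational s /\ 0 < s < 1.
Proof.
  exists (/ sqrt 2).
  assert (H2 : sqrt 2 * sqrt 2 = 2) by (apply sqrt_sqrt; lra).
  assert (H0 : 0 < sqrt 2) by (apply sqrt_lt_R0; lra).
  split.
  - intros Hs. apply rational_inv in Hs.
    2:{ apply Rinv_neq_0_compat; lra. }
    rewrite Rinv_inv in Hs. destruct Hs as (p & q & Hq & E).
    assert (Hq' := not_0_IZR _ Hq).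
    assert (HZ : (p * p = 2 * (q * q))%Z).
    { apply eq_IZR. rewrite !mult_IZR, <- H2, E. now field. }
    assert (Hn : (Z.abs_nat p * Z.abs_nat p = 2 * (Z.abs_nat q * Z.abs_nat q))%nat).
    { apply Nat2Z.inj. rewrite !Nat2Z.inj_mul, !Nat2Z.inj_abs_nat. nia. }
    apply sqr_eq_double in Hn. lia.
  - split; [now apply Rinv_0_lt_compat|].
    rewrite <- Rinv_1. apply Rinv_lt_contravar; nra.
Qed.

(** * Powers of additive functions *)

Definition additive (phi : R -> R) : Prop :=
  forall x y, phi (x + y) = phi x + phi y.

Lemma additive_0 (phi : R -> R) : additive phi -> phi 0 = 0.
Proof. intros H. generalize (H 0 0). rewrite Rplus_0_l. lra. Qed.

Lemma additive_multiple (phi : R -> R) (k : nat) (x : R) :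
  additive phi -> phi (INR k * x) = INR k * phi x.
Proof.
  intros H. induction k as [|k IH].
  - simpl. rewrite !Rmult_0_l. now apply additive_0.
  - rewrite S_INR, Rmult_plus_distr_r, Rmult_1_l, H, IH. ring.
Qed.

(** The Leibniz rule for differences; only two terms survive because the second difference of [phi]
    vanishes. *)
Lemma Delta_n_mul_additive (phi g : R -> R) (h : R) (m : nat) (x : R) :
  additive phi ->
  Delta_n h (S m) (fun y => phi y * g y) x =
  phi (x + INR (S m) * h) * Delta_n h (S m) g x
  + INR (S m) * phi h * Delta_n h m g x.
Proof.
  intros H. revert x. induction m as [|m IH]; intros x.
  - cbn [Delta_n]. unfold Delta. change (INR 1) with 1.
    rewrite Rmult_1_l, H. ring.
  - change (Delta_n h (S (S m)) ?F x) with (Delta h (Delta_n h (S m) F) x).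
    unfold Delta at 1. rewrite !IH.
    assert (E : Delta_n h m g (x + h) = Delta_n h (S m) g x + Delta_n h m g x)
      by (simpl; unfold Delta; ring).
    rewrite E, !H, !additive_multiple by assumption.
    rewrite (additive_multiple phi (S (S m))) by assumption.
    rewrite (S_INR (S m)). unfold Delta. ring.
Qed.

(** Induction by the Leibniz rule for [phi * phi^n]: the [n]-th difference of [phi^n] is constant,
    so the next one vanishes and only the term with the factor [(n + 1) phi h] remains. *)
Lemma Delta_n_pow_additive (phi : R -> R) (h : R) (n : nat) :
  additive phi ->
  (forall x, Delta_n h n (fun y => phi y ^ n) x = INR (fact n) * phi h ^ n) /\
  (forall x, Delta_n h (S n) (fun y => phi y ^ n) x = 0).
Proof.
  intros H.
  assert (K : forall m, (forall x, Delta_n h m (fun y => phi y ^ m) x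
                                   = INR (fact m) * phi h ^ m) ->
              forall x, Delta_n h (S m) (fun y => phi y ^ m) x = 0).
  { intros m Hm x. cbn [Delta_n]. unfold Delta. rewrite !Hm. ring. }
  enough (forall x, Delta_n h n (fun y => phi y ^ n) x = INR (fact n) * phi h ^ n)
    by (split; auto).
  induction n as [|n IH]; intros x; [simpl; ring|].
  change (fun y => phi y ^ S n) with (fun y => phi y * phi y ^ n).
  rewrite (Delta_n_mul_additive phi (fun y => phi y ^ n)) by assumption.
  rewrite (K n IH), IH.
  change (fact (S n)) with (S n * fact n)%nat. rewrite mult_INR. simpl pow. ring.
Qed.

Lemma monomial_pow_additive (phi : R -> R) (n : nat) :
  additive phi -> monomial n (fun x => phi x ^ n).
Proof.
  intros H x h. rewrite (proj1 (Delta_n_pow_additive phi h n H)).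
  field. apply INR_fact_neq_0.
Qed.

(** * Connectedness of graphs *)

Lemma dist2_fst (p q : R2) : Rabs (fst p - fst q) <= dist2 p q.
Proof.
  unfold dist2. rewrite <- sqrt_Rsqr_abs. apply sqrt_le_1_alt. unfold Rsqr.
  pose proof (pow2_ge_0 (snd p - snd q)). simpl in *. lra.
Qed.

Lemma dist2_snd (p q : R2) : Rabs (snd p - snd q) <= dist2 p q.
Proof.
  unfold dist2. rewrite <- sqrt_Rsqr_abs. apply sqrt_le_1_alt. unfold Rsqr.
  pose proof (pow2_ge_0 (fst p - fst q)). simpl in *. lra.
Qed.

Lemma dist2_le (p q : R2) :
  dist2 p q <= Rabs (fst p - fst q) + Rabs (snd p - snd q).
Proof.
  pose proof (Rabs_pos (fst p - fst q)). pose proof (Rabs_pos (snd p - snd q)).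
  unfold dist2. rewrite <- (pow2_abs (fst p - fst q)), <- (pow2_abs (snd p - snd q)).
  rewrite <- (sqrt_pow2 (Rabs (fst p - fst q) + Rabs (snd p - snd q))) by lra.
  apply sqrt_le_1_alt. nra.
Qed.

Lemma open2_boxP (U : R2 -> Prop) :
  open2 U <->
  forall x y, U (x, y) -> exists eps, 0 < eps /\
    forall x' y', Rabs (x' - x) < eps -> Rabs (y' - y) < eps -> U (x', y').
Proof.
  split.
  - intros HU x y Hxy. destruct (HU _ Hxy) as (eps & Heps & H).
    exists (eps / 2). split; [lra|]. intros x' y' Hx Hy. apply H.
    apply Rle_lt_trans with (1 := dist2_le _ _). simpl.
    rewrite (Rabs_minus_sym x), (Rabs_minus_sym y). lra.
  - intros HU [x y] Hxy. destruct (HU _ _ Hxy) as (eps & Heps & H).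
    exists eps. split; [exact Heps|]. intros [x' y'] Hd. apply H.
    + rewrite Rabs_minus_sym. exact (Rle_lt_trans _ _ _ (dist2_fst (x, y) (x', y')) Hd).
    + rewrite Rabs_minus_sym. exact (Rle_lt_trans _ _ _ (dist2_snd (x, y) (x', y')) Hd).
Qed.

(** Connectedness of [[a, b]]: let [m] be the supremum of the points up to which [P] keeps its value
    at [a]. Local constancy at [m] carries this value beyond [m], unless [m = b]. *)
Lemma locally_constant (P : R -> Prop) (a b : R) :
  a <= b ->
  (forall x, a <= x <= b -> exists eps, 0 < eps /\
     forall y, a <= y <= b -> Rabs (y - x) < eps -> (P y <-> P x)) ->
  (P a <-> P b).
Proof.
  intros Hab Hloc.
  set (E := fun t => a <= t <= b /\ forall y, a <= y <= t -> (P y <-> P a)).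
  assert (Ea : E a).
  { split; [lra|]. intros y Hy. replace y with a by lra. tauto. }
  destruct (completeness E) as [m [Hub Hlub]].
  { exists b. intros t [Ht _]. lra. }
  { now exists a. }
  assert (Hm : a <= m <= b).
  { split; [now apply Hub|]. apply Hlub. intros t [Ht _]. lra. }
  destruct (Hloc m Hm) as (eps & Heps & Hnear).
  assert (Ht : exists t, E t /\ m - eps < t).
  { apply NNPP. intros Hno. assert (m <= m - eps); [|lra].
    apply Hlub. intros t Et. apply Rnot_lt_le. intros Hlt. apply Hno. now exists t. }
  destruct Ht as (t & [Ht1 Ht2] & Ht3).
  assert (Htm : t <= m) by (apply Hub; split; assumption).
  assert (Pm : P m <-> P a).
  { rewrite <- (Hnear t), (Ht2 t); [tauto|lra|lra|].
    apply Rabs_def1; lra. }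
  set (u := Rmin b (m + eps / 2)).
  assert (Hu : m <= u <= b /\ u <= m + eps / 2 /\ (u = b \/ u = m + eps / 2)).
  { unfold u, Rmin. destruct (Rle_dec b (m + eps / 2)); lra. }
  assert (Eu : E u).
  { split; [lra|]. intros y Hy. destruct (Rle_dec y t) as [Hyt|Hyt].
    - apply Ht2; lra.
    - rewrite <- Pm. apply Hnear; [lra|]. apply Rabs_def1; lra. }
  assert (Hum : u <= m) by now apply Hub.
  assert (Hub' : u = b) by lra. rewrite Hub' in Eu.
  destruct Eu as [_ Eu]. rewrite (Eu b) by lra. tauto.
Qed.

Lemma locally_constant_R (P : R -> Prop) :
  (forall x, exists eps, 0 < eps /\ forall y, Rabs (y - x) < eps -> (P y <-> P x)) ->
  forall a b, P a -> P b.
Proof.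
  intros Hloc a b.
  destruct (Rle_dec a b) as [Hab|Hab].
  - apply (locally_constant P a b Hab). intros x _.
    destruct (Hloc x) as (eps & Heps & H). exists eps. auto.
  - apply (locally_constant P b a); [lra|]. intros x _.
    destruct (Hloc x) as (eps & Heps & H). exists eps. auto.
Qed.

(* A connected subset of the plane with points over [a] and [b] has points over
   everything in between; inside a graph there is only one such point. *)
Lemma connected_subgraph_between (f : R -> R) (T : R2 -> Prop) (a b c : R) :
  (forall p, T p -> graph f p) -> connected2 T ->
  T (a, f a) -> T (b, f b) -> a < c < b -> T (c, f c).
Proof.
  intros Tf HT Ta Tb Hc. apply NNPP. intros Tc. apply HT.
  exists (fun p => fst p < c), (fun p => c < fst p).
  split; [|split; [|split; [|split; [|split]]]].
  - apply open2_boxP. intros x y Hx. simpl in Hx. exists (c - x). split; [lra|].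
    intros x' y' H _. apply Rabs_def2 in H. simpl. lra.
  - apply open2_boxP. intros x y Hx. simpl in Hx. exists (x - c). split; [lra|].
    intros x' y' H _. apply Rabs_def2 in H. simpl. lra.
  - intros [x y] Txy. simpl. generalize (Tf _ Txy). unfold graph; simpl. intros ->.
    destruct (Rtotal_order x c) as [H|[->|H]]; tauto.
  - exists (a, f a). simpl. split; [assumption|lra].
  - exists (b, f b). simpl. split; [assumption|lra].
  - intros p _. simpl. lra.
Qed.

Lemma open2_scale (U : R2 -> Prop) (r s : R) :
  open2 U -> open2 (fun p => U (r * fst p, s * snd p)).
Proof.
  rewrite !open2_boxP. intros HU x y Hxy. simpl in Hxy.
  destruct (HU _ _ Hxy) as (eps & Heps & H).
  pose proof (Rabs_pos r). pose proof (Rabs_pos s).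
  (* The [+ 1] keeps [k] positive when [r = s = 0]. *)
  set (k := Rabs r + Rabs s + 1).
  assert (Hk : 0 < k) by (unfold k; lra).
  exists (eps / k). split; [now apply Rdiv_lt_0_compat|].
  assert (bound : forall c t t', Rabs c <= k -> Rabs (t' - t) < eps / k ->
                    Rabs (c * t' - c * t) < eps).
  { intros c t t' Hc Ht. rewrite <- Rmult_minus_distr_l, Rabs_mult.
    apply Rle_lt_trans with (k * Rabs (t' - t)).
    - apply Rmult_le_compat_r; [apply Rabs_pos|exact Hc].
    - apply (Rmult_lt_compat_l k) in Ht; [|exact Hk].
      replace (k * (eps / k)) with eps in Ht by (field; lra). exact Ht. }
  intros x' y' Hx Hy. simpl. apply H; apply bound; try assumption; unfold k; lra.
Qed.

Lemma connected_over_interval_connected (n : nat) (f : R -> R) (T : R2 -> Prop)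
    (a b : R) :
  (1 <= n)%nat -> monomial n f ->
  (forall p, T p -> graph f p) -> connected2 T ->
  T (a, f a) -> T (b, f b) -> a < b -> connected2 (graph f).
Proof.
  intros Hn Hf Tf HT Ta Tb Hab (U & V & HU & HV & Hcov & [pu [Gu Uu]] & [pv [Gv Vv]] & Hdisj).
  (* [P x] says on which side of the separation the graph point over [x] lies; the aim is to show
     that [P] is constant. *)
  pose (P := fun x => U (x, f x)).
  assert (PV : forall x, V (x, f x) <-> ~ P x).
  { intros x. split.
    - intros Vx Px. exact (Hdisj (x, f x) eq_refl Px Vx).
    - intros Px. destruct (Hcov (x, f x) eq_refl); tauto. }
  (* The dilations [(x, y) |-> (r x, r^n y)] preserve the graph. *)
  assert (Pconst : forall r x y, rational r -> a < x < b -> a < y < b ->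
            P (r * x) -> P (r * y)).
  { intros r x y Hr Hx Hy Px. apply NNPP. intros Py. apply PV in Py.
    (* The preimages of [U] and [V] under the dilation by [r] would separate [T], with the points
       over [x] and [y] on different sides. *)
    apply HT.
    exists (fun p => U (r * fst p, r ^ n * snd p)), (fun p => V (r * fst p, r ^ n * snd p)).
    assert (dil : forall p, T p -> graph f (r * fst p, r ^ n * snd p)).
    { intros p Tp. unfold graph; simpl. rewrite (monomial_rational n f r _ Hf Hr).
      now rewrite (Tf p Tp). }
    split; [now apply open2_scale|]. split; [now apply open2_scale|].
    split; [intros p Tp; apply Hcov; now apply dil|].
    split; [|split].
    - exists (x, f x). split; [now apply (connected_subgraph_between f T a b)|].
      simpl. rewrite <- (monomial_rational n f r x Hf Hr). exact Px.
    - exists (y, f y). split; [now apply (connected_subgraph_between f T a b)|].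
      simpl. rewrite <- (monomial_rational n f r y Hf Hr). exact Py.
    - intros p Tp. apply Hdisj. now apply dil. }
  assert (Ploc : forall z, z <> 0 -> exists eps, 0 < eps /\
            forall z', Rabs (z' - z) < eps -> (P z' <-> P z)).
  { intros z Hz.
    (* The factor [s] moves [z] and its neighbours into [(a, b)]; [Pconst] with ratio [/ s] then
       compares them. *)
    destruct (rational_multiple_dense z a b Hz Hab) as (s & Hs & Hs0 & Hsz).
    assert (Hs' : 0 < Rabs s) by now apply Rabs_pos_lt.
    set (d := Rmin (s * z - a) (b - s * z)).
    assert (Hd : 0 < d /\ d <= s * z - a /\ d <= b - s * z).
    { unfold d. split; [apply Rmin_pos; lra|]. split; [apply Rmin_l|apply Rmin_r]. }
    exists (d / Rabs s). split; [apply Rdiv_lt_0_compat; lra|].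
    intros z' Hz'.
    assert (Hsz' : a < s * z' < b).
    { apply (Rmult_lt_compat_l (Rabs s)) in Hz'; [|exact Hs'].
      replace (Rabs s * (d / Rabs s)) with d in Hz' by (field; lra).
      rewrite <- Rabs_mult in Hz'. apply Rabs_def2 in Hz'. lra. }
    assert (Hr := rational_inv s Hs0 Hs).
    assert (E : forall t, t = / s * (s * t)) by (intros t; now field).
    rewrite (E z'), (E z). split; now apply Pconst. }
  assert (f0 := monomial_0 n f Hn Hf).
  (* Dilations fix [0], so there only openness is available; it controls those [z] near [0] for
     which [f z] is small too. *)
  assert (P0loc : exists eps, 0 < eps /\ forall z, Rabs z < eps -> Rabs (f z) < eps ->
            (P z <-> P 0)).
  { destruct (classic (P 0)) as [H0|H0].
    - destruct (proj1 (open2_boxP U) HU _ _ H0) as (eps & Heps & H).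
      exists eps. split; [exact Heps|]. intros z Hz Hfz. split; [tauto|]. intros _.
      apply H; [now rewrite Rminus_0_r|now rewrite f0, Rminus_0_r].
    - assert (V0 := proj2 (PV 0) H0).
      destruct (proj1 (open2_boxP V) HV _ _ V0) as (eps & Heps & H).
      exists eps. split; [exact Heps|]. intros z Hz Hfz. split; [|tauto].
      intros Pz. exfalso. revert Pz. apply PV.
      apply H; [now rewrite Rminus_0_r|now rewrite f0, Rminus_0_r]. }
  destruct P0loc as (eps & Heps & P0).
  assert (Pall : forall z, P z <-> P 0).
  { intros z. destruct (Req_dec z 0) as [->|Hz]; [tauto|].
    pose proof (Rabs_pos z) as Hz0. pose proof (Rabs_pos (f z)) as Hfz0.
    (* For [w = 1 / (N + 1)] both coordinates [w z] and [w^n f z] of the graph point over [w z] fall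
       below [eps]; the second uses [w^n <= w]. *)
    destruct (exists_large_nat ((Rabs z + Rabs (f z)) / eps + 1)) as [N HN].
    assert (HN1 : 1 <= INR (S N)).
    { assert (0 <= (Rabs z + Rabs (f z)) / eps); [|lra].
      apply Rmult_le_pos; [lra|]. apply Rlt_le, Rinv_0_lt_compat, Heps. }
    assert (HN2 : Rabs z + Rabs (f z) < INR (S N) * eps).
    { apply (Rmult_lt_compat_r eps) in HN; [|exact Heps].
      replace (((Rabs z + Rabs (f z)) / eps + 1) * eps)
        with (Rabs z + Rabs (f z) + eps) in HN by (field; lra). lra. }
    set (w := / INR (S N)).
    assert (Hw : 0 < w <= 1).
    { unfold w. split; [apply Rinv_0_lt_compat; lra|].
      rewrite <- Rinv_1. apply Rinv_le_contravar; lra. }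
    assert (Hweps : w * (Rabs z + Rabs (f z)) < eps).
    { apply (Rmult_lt_compat_l w) in HN2; [|lra].
      replace (w * (INR (S N) * eps)) with eps in HN2
        by (unfold w; field; lra). exact HN2. }
    assert (Hwr : rational w).
    { exists 1%Z, (Z.of_nat (S N)). split; [lia|]. unfold w.
      rewrite <- INR_IZR_INZ. field. lra. }
    assert (Hpow : 0 < w ^ n <= w).
    { split; [apply pow_lt; lra|]. destruct n as [|m]; [lia|]. simpl.
      assert (w ^ m <= 1) by (rewrite <- (pow1 m); apply pow_incr; lra).
      assert (0 < w ^ m) by (apply pow_lt; lra). nra. }
    rewrite <- (P0 (w * z)).
    (* The points [z] and [w z] lie on the same side of [0], so [P] is locally constant on the
       segment between them. *)
    - destruct (Rdichotomy z 0 Hz) as [Hneg|Hpos].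
      + apply (locally_constant P z (w * z)); [nra|]. intros x Hx.
        destruct (Ploc x) as (d & Hd & H); [nra|]. exists d. auto.
      + symmetry. apply (locally_constant P (w * z) z); [nra|]. intros x Hx.
        destruct (Ploc x) as (d & Hd & H); [nra|]. exists d. auto.
    - rewrite Rabs_mult, (Rabs_pos_eq w) by lra. nra.
    - rewrite (monomial_rational n f w z Hf Hwr), Rabs_mult, (Rabs_pos_eq (w ^ n)) by lra.
      nra. }
  destruct pu as [xu yu], pv as [xv yv]. unfold graph in Gu, Gv; simpl in Gu, Gv.
  subst yu yv. apply (proj1 (PV xv) Vv). apply Pall, (Pall xu), Uu.
Qed.

(** Distinct points of one component lie over distinct abscissas, so a connected set joining them
    makes the whole graph connected. *)
Lemma monomial_graph_dichotomy (n : nat) (f : R -> R) :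
  (1 <= n)%nat -> monomial n f ->
  connected2 (graph f) \/ totally_disconnected2 (graph f).
Proof.
  intros Hn Hf.
  destruct (classic (connected2 (graph f))) as [H|H]; [now left|right].
  intros [a ya] Ga [b yb] (T & Tf & HT & Ta & Tb).
  assert (Gb := Tf _ Tb). unfold graph in Ga, Gb; simpl in Ga, Gb. subst ya yb.
  destruct (Rtotal_order a b) as [Hab|[->|Hab]]; [|reflexivity|]; exfalso; apply H.
  - now apply (connected_over_interval_connected n f T a b).
  - now apply (connected_over_interval_connected n f T b a).
Qed.

(** * Extension of partial additive functions *)

(* [W] is the graph of a partial [Q]-linear function with values in [Y]. *)
Record partial_linear (Y : R -> Prop) (W : R2 -> Prop) : Prop := {
  partial_linear_comb : forall q u v u' v', rational q ->
    W (u, v) -> W (u', v') -> W (u + q * u', v + q * v');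
  partial_linear_functional : forall v, W (0, v) -> v = 0;
  partial_linear_range : forall u v, W (u, v) -> Y v }.

(** By Zorn's lemma there is a maximal partial linear extension. It is total, since a missing [x]
    could be adjoined with value [0]. *)
Lemma additive_extension (Y : R -> Prop) (W0 : R2 -> Prop) :
  partial_linear Y W0 -> W0 (0, 0) ->
  exists phi, additive phi /\ (forall u v, W0 (u, v) -> phi u = v) /\
              forall x, Y (phi x).
Proof.
  intros HW0 H00.
  destruct (@classical_sets.Zorn_bigcup R2
              (fun A => partial_linear Y (fun p => W0 p \/ A p))) as (A & HA & Amax).
  { intros F HF Ftot.
    (* [F] may be empty, so [W0] has to be joined to the union of the chain. *)
    assert (K : forall p p', (W0 p \/ classical_sets.bigcup F (fun X => X) p) ->
                (W0 p' \/ classical_sets.bigcup F (fun X => X) p') ->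
                (W0 p /\ W0 p') \/
                exists X, F X /\ (W0 p \/ X p) /\ (W0 p' \/ X p')).
    { intros p p' [Hp|[X FX Xp]] [Hp'|[X' FX' Xp']].
      - left; tauto.
      - right; exists X'; tauto.
      - right; exists X; tauto.
      - right. destruct (Ftot X X' FX FX') as [S|S].
        + exists X'. split; [assumption|]. split; right; auto.
        + exists X. split; [assumption|]. split; right; auto. }
    split.
    - intros q u v u' v' Hq H H'.
      destruct (K _ _ H H') as [[W W']|(X & FX & W & W')].
      + left. now apply (partial_linear_comb Y W0 HW0).
      + destruct (partial_linear_comb Y _ (HF X FX) q u v u' v' Hq W W') as [C|C];
          [now left|right; now exists X].
    - intros v H. destruct (K _ _ H H) as [[W W']|(X & FX & W & _)].
      + now apply (partial_linear_functional Y W0 HW0).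
      + now apply (partial_linear_functional Y _ (HF X FX)).
    - intros u v H. destruct (K _ _ H H) as [[W W']|(X & FX & W & _)].
      + now apply (partial_linear_range Y W0 HW0 u).
      + now apply (partial_linear_range Y _ (HF X FX) u). }
  set (W := fun p => W0 p \/ A p) in HA.
  assert (W00 : W (0, 0)) by (left; assumption).
  assert (Wmul : forall q u v, rational q -> W (u, v) -> W (q * u, q * v)).
  { intros q u v Hq H. rewrite <- (Rplus_0_l (q * u)), <- (Rplus_0_l (q * v)).
    now apply (partial_linear_comb Y W HA). }
  assert (total : forall x, exists y, W (x, y)).
  { intros x. apply NNPP. intros Hx.
    (* The span of [W] and [(x, 0)]; its values are already values of [W], so the range stays inside
       [Y]. *)
    pose (B := fun p : R2 => exists u q, rational q /\ W (u, snd p) /\ fst p = u + q * x).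
    assert (WB : forall p, W p -> B p).
    { intros [u v] H. exists u, 0. split; [apply (rational_IZR 0)|]. simpl.
      split; [assumption|ring]. }
    assert (Bx : B (x, 0)).
    { exists 0, 1. split; [apply (rational_IZR 1)|]. simpl. split; [assumption|ring]. }
    apply (Amax B).
    - split.
      + intros p Ap. apply WB. now right.
      + intros S. apply Hx. exists 0. right. now apply S.
    - assert (W0B : forall p, W0 p \/ B p -> B p).
      { intros p [H|H]; [apply WB; now left|assumption]. }
      split.
      + intros q u v u' v' Hq H H'. right.
        destruct (W0B _ H) as (u1 & q1 & Hq1 & H1 & E1).
        destruct (W0B _ H') as (u2 & q2 & Hq2 & H2 & E2).
        simpl in *. exists (u1 + q * u2), (q1 + q * q2). split.
        { apply rational_plus; [assumption|]. now apply rational_mult. }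
        split; [now apply (partial_linear_comb Y W HA)|]. simpl.
        rewrite E1, E2. ring.
      + intros v H. destruct (W0B _ H) as (u1 & q1 & Hq1 & H1 & E1).
        simpl in *. destruct (Req_dec q1 0) as [->|Hq0].
        * assert (u1 = 0) by lra. subst u1.
          now apply (partial_linear_functional Y W HA).
        (* For [q1 <> 0] the point [x = - u1 / q1] would already belong to the domain of [W]. *)
        * exfalso. apply Hx. exists (- / q1 * v).
          replace x with (- / q1 * u1).
          { apply Wmul; [|assumption].
            replace (- / q1) with (-1 * / q1) by ring.
            apply rational_mult; [apply rational_IZR|now apply rational_inv]. }
          replace u1 with (- (q1 * x)) by lra. now field.
      + intros u v H. destruct (W0B _ H) as (u1 & q1 & Hq1 & H1 & E1).
        now apply (partial_linear_range Y W HA u1). }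
  destruct (boolp.choice total) as [phi Hphi].
  assert (unique : forall u v, W (u, v) -> phi u = v).
  { intros u v H.
    assert (v + -1 * phi u = 0); [|lra].
    apply (partial_linear_functional Y W HA).
    replace 0 with (u + -1 * u) by ring.
    apply (partial_linear_comb Y W HA); auto. apply (rational_IZR (-1)). }
  exists phi. split; [|split].
  - intros x y. apply unique.
    replace (x + y) with (x + 1 * y) by ring.
    replace (phi x + phi y) with (phi x + 1 * phi y) by ring.
    apply (partial_linear_comb Y W HA); auto. apply (rational_IZR 1).
  - intros u v H. apply unique. now left.
  - intros x. apply (partial_linear_range Y W HA x). apply Hphi.
Qed.

(** * A rationally independent family indexed by binary sequences *)

(** Partial sums of an expansion with digits [0] and [1] in factorial base: [n!] times the sum up to
    [n] is an integer, while the tail is at most [1 / (n n!)]. *)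
Fixpoint inv_fact_sum (s : nat -> bool) (n : nat) : R :=
  match n with
  | O => INR (Nat.b2n (s 0%nat))
  | S m => inv_fact_sum s m + INR (Nat.b2n (s n)) / INR (fact n)
  end.

Lemma fact_inv_fact_sum_integer (s : nat -> bool) (n : nat) :
  exists N : Z, INR (fact n) * inv_fact_sum s n = IZR N.
Proof.
  induction n as [|n [N IH]].
  - exists (Z.of_nat (Nat.b2n (s 0%nat))). simpl. rewrite <- INR_IZR_INZ. ring.
  - exists (Z.of_nat (S n) * N + Z.of_nat (Nat.b2n (s (S n))))%Z.
    rewrite plus_IZR, mult_IZR, <- !INR_IZR_INZ, <- IH.
    cbn [inv_fact_sum]. set (b := INR (Nat.b2n (s (S n)))).
    change (fact (S n)) with (S n * fact n)%nat. rewrite mult_INR.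
    field. split; [apply INR_fact_neq_0|apply not_0_INR; lia].
Qed.

Lemma b2n_bounds (b : bool) : 0 <= INR (Nat.b2n b) <= 1.
Proof. destruct b; simpl; lra. Qed.

Lemma inv_fact_sum_incr (s : nat -> bool) (n k : nat) :
  inv_fact_sum s n <= inv_fact_sum s (n + k).
Proof.
  induction k as [|k IH]; [rewrite Nat.add_0_r; lra|].
  rewrite Nat.add_succ_r. cbn [inv_fact_sum].
  pose proof (b2n_bounds (s (S (n + k)))) as [H _].
  pose proof (INR_fact_lt_0 (S (n + k))) as Hf. apply Rinv_0_lt_compat in Hf.
  unfold Rdiv. nra.
Qed.

(* [1/(n+1)! <= 1/(n n!) - 1/((n+1) (n+1)!)]. *)
Lemma inv_fact_sum_upper_decr (s : nat -> bool) (n k : nat) : (1 <= n)%nat ->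
  inv_fact_sum s (n + k) + / (INR (n + k) * INR (fact (n + k)))
  <= inv_fact_sum s n + / (INR n * INR (fact n)).
Proof.
  intros Hn. induction k as [|k IH]; [rewrite Nat.add_0_r; lra|].
  apply Rle_trans with (2 := IH). clear IH.
  rewrite Nat.add_succ_r. set (m := (n + k)%nat).
  assert (Hm : 1 <= INR m) by (apply (le_INR 1); unfold m; lia).
  cbn [inv_fact_sum]. pose proof (b2n_bounds (s (S m))) as [Hb0 Hb1].
  set (b := INR (Nat.b2n (s (S m)))) in *.
  change (fact (S m)) with (S m * fact m)%nat. rewrite mult_INR, S_INR.
  pose proof (INR_fact_lt_0 m) as Hf. set (x := INR m) in *. set (F := INR (fact m)) in *.
  assert (0 < / F) by now apply Rinv_0_lt_compat.
  assert (E : / (x * F) - / ((x + 1) * ((x + 1) * F)) - b / ((x + 1) * F)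
          = ((x + 1) * (x + 1) - x - b * (x * (x + 1))) * / (x * (x + 1) * (x + 1)) * / F).
  { field. repeat split; lra. }
  assert (0 < / (x * (x + 1) * (x + 1))) by (apply Rinv_0_lt_compat; nra).
  assert (0 <= (x + 1) * (x + 1) - x - b * (x * (x + 1))) by nra.
  assert (0 <= ((x + 1) * (x + 1) - x - b * (x * (x + 1)))
               * / (x * (x + 1) * (x + 1)) * / F).
  { apply Rmult_le_pos; [apply Rmult_le_pos|]; lra. }
  lra.
Qed.

(** Nested intervals: the sums increase, the upper bounds decrease, and every sum is below every
    upper bound, so the supremum of the sums works. *)
Lemma inv_fact_series (s : nat -> bool) :
  exists x, forall n, (1 <= n)%nat ->
    inv_fact_sum s n <= x <= inv_fact_sum s n + / (INR n * INR (fact n)).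
Proof.
  assert (cross : forall n m, (1 <= n)%nat ->
            inv_fact_sum s m <= inv_fact_sum s n + / (INR n * INR (fact n))).
  { intros n m Hn.
    apply Rle_trans with (inv_fact_sum s (n + m)).
    { rewrite Nat.add_comm. apply inv_fact_sum_incr. }
    apply Rle_trans with (2 := inv_fact_sum_upper_decr s n m Hn).
    assert (0 < / (INR (n + m) * INR (fact (n + m)))); [|lra].
    apply Rinv_0_lt_compat, Rmult_lt_0_compat; [apply lt_0_INR; lia|apply INR_fact_lt_0]. }
  destruct (completeness (fun y => exists n, y = inv_fact_sum s n)) as [x [Hub Hlub]].
  { eexists. intros y [m ->]. now apply (cross 1%nat). }
  { now exists (inv_fact_sum s 0), 0%nat. }
  exists x. intros n Hn. split.
  - apply Hub. now exists n.
  - apply Hlub. intros y [m ->]. now apply cross.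
Qed.

(** The number with binary digits [1, a 0, ..., a (k-1)]; the leading [1] makes the length
    recoverable. *)
Fixpoint prefix_code (a : nat -> bool) (k : nat) : nat :=
  match k with
  | O => 1
  | S j => 2 * prefix_code a j + Nat.b2n (a j)
  end.

Lemma prefix_code_gt (a : nat -> bool) (k : nat) : (k < prefix_code a k)%nat.
Proof. induction k as [|k IH]; simpl; lia. Qed.

Lemma prefix_code_inj (a b : nat -> bool) (k l : nat) :
  prefix_code a k = prefix_code b l -> k = l /\ forall i, (i < k)%nat -> a i = b i.
Proof.
  revert l. induction k as [|k IH]; intros [|l] H; cbn [prefix_code] in H.
  - split; [reflexivity|intros; lia].
  - pose proof (prefix_code_gt b l). lia.
  - pose proof (prefix_code_gt a k). lia.
  - assert (E : prefix_code a k = prefix_code b l /\ a k = b l).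
    { destruct (a k), (b l); simpl in H; split; try reflexivity; lia. }
    destruct E as [E1 E2]. destruct (IH l E1) as [-> E3].
    split; [reflexivity|]. intros i Hi.
    destruct (Nat.eq_dec i l) as [->|Hil]; [assumption|apply E3; lia].
Qed.

Definition decide (P : Prop) : bool :=
  if excluded_middle_informative P then true else false.

Lemma decideP (P : Prop) : decide P = true <-> P.
Proof. unfold decide. destruct (excluded_middle_informative P); intuition discriminate. Qed.

Lemma decide_false (P : Prop) : ~ P -> decide P = false.
Proof. unfold decide. destruct (excluded_middle_informative P); tauto. Qed.

Definition prefix_set (a : nat -> bool) (j : nat) : bool :=
  decide (exists k, j = prefix_code a k).

(** A prefix of [b] that reaches past a position where [a] and [b] differ is not a prefix of [a]. *)
Lemma prefix_set_almost_disjoint (a b : nat -> bool) :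
  exists K, forall k, (K <= k)%nat ->
    prefix_set a (prefix_code b k) = decide (a = b).
Proof.
  destruct (classic (a = b)) as [->|Hab].
  - exists 0%nat. intros k _. rewrite (proj2 (decideP (b = b)) eq_refl).
    apply decideP. now exists k.
  - rewrite (decide_false _ Hab).
    assert (Hi : exists i, a i <> b i).
    { apply NNPP. intros H. apply Hab, functional_extensionality. intros i.
      apply NNPP. intros Hi. apply H. now exists i. }
    destruct Hi as [i Hi]. exists (S i). intros k Hk. apply decide_false.
    intros [l E]. apply Hi. symmetry. apply (prefix_code_inj b a k l E). lia.
Qed.

Notation index := (nat -> bool).

(** Coefficients are integers because denominators get cleared. An index may occur repeatedly, so
    that concatenation is addition; [total_coef] collects the occurrences. *)
Definition comb (w : index -> R) (l : list (Z * index)) : R :=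
  fold_right (fun t acc => IZR (fst t) * w (snd t) + acc) 0 l.

Definition total_coef (b : index) (l : list (Z * index)) : Z :=
  fold_right (fun t acc => fst t * Z.b2z (decide (snd t = b)) + acc)%Z 0%Z l.

Definition digit_sum (c : nat) (l : list (Z * index)) : Z :=
  fold_right (fun t acc => fst t * Z.b2z (prefix_set (snd t) c) + acc)%Z 0%Z l.

Definition abs_sum (l : list (Z * index)) : Z :=
  fold_right (fun t acc => Z.abs (fst t) + acc)%Z 0%Z l.

Lemma comb_app (w : index -> R) (l l' : list (Z * index)) :
  comb w (l ++ l') = comb w l + comb w l'.
Proof. induction l as [|t l IH]; simpl; [ring|]. rewrite IH. ring. Qed.

Lemma comb_scale (w : index -> R) (d : Z) (l : list (Z * index)) :
  comb w (map (fun t => (d * fst t, snd t)%Z) l) = IZR d * comb w l.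
Proof.
  induction l as [|t l IH]; simpl; [ring|]. rewrite IH, mult_IZR. ring.
Qed.

Definition without (b : index) (l : list (Z * index)) : list (Z * index) :=
  filter (fun t => negb (decide (snd t = b))) l.

Lemma comb_without (w : index -> R) (b : index) (l : list (Z * index)) :
  comb w l = IZR (total_coef b l) * w b + comb w (without b l).
Proof.
  induction l as [|[m a] l IH]; simpl; [ring|].
  destruct (classic (a = b)) as [->|Hab].
  - rewrite (proj2 (decideP (b = b)) eq_refl). simpl.
    rewrite IH, plus_IZR, mult_IZR. ring.
  - rewrite (decide_false _ Hab). simpl. rewrite IH, plus_IZR, mult_IZR. ring.
Qed.

Lemma total_coef_without (b c : index) (l : list (Z * index)) :
  total_coef c l = 0%Z -> total_coef c (without b l) = 0%Z.
Proof.
  assert (H : total_coef c (without b l)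
              = if decide (c = b) then 0%Z else total_coef c l).
  { induction l as [|[m a] l IH]; simpl; [now destruct (decide (c = b))|].
    destruct (classic (a = b)) as [->|Hab].
    - rewrite (proj2 (decideP (b = b)) eq_refl). simpl. rewrite IH.
      destruct (classic (c = b)) as [->|Hcb].
      + now rewrite (proj2 (decideP (b = b)) eq_refl).
      + rewrite (decide_false (c = b)), (decide_false (b = c)) by congruence.
        simpl. ring.
    - rewrite (decide_false _ Hab). simpl. rewrite IH.
      destruct (classic (c = b)) as [->|Hcb].
      + rewrite (proj2 (decideP (b = b)) eq_refl), (decide_false _ Hab). simpl. ring.
      + now rewrite (decide_false (c = b)) by assumption. }
  intros E. rewrite H, E. now destruct (decide (c = b)).
Qed.

(** Induction on the length: deleting all occurrences of the leading index drops a term with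
    coefficient [0] and keeps every total coefficient zero. *)
Lemma comb_total_coef_0 (w : index -> R) (l : list (Z * index)) :
  (forall b, total_coef b l = 0%Z) -> comb w l = 0.
Proof.
  remember (length l) as n eqn:Hn. revert l Hn.
  induction n as [n IH] using lt_wf_ind. intros [|[m b] l] -> H; [reflexivity|].
  rewrite (comb_without w b), H.
  rewrite (IH (length (without b ((m, b) :: l)))) with (l := without b ((m, b) :: l)).
  - ring.
  - simpl. rewrite (proj2 (decideP (b = b)) eq_refl). simpl.
    apply Nat.lt_succ_r, filter_length_le.
  - reflexivity.
  - intros c. apply total_coef_without, H.
Qed.

(* [c! e_a] is a multiple of [c] plus the digit [prefix_set a c] plus a
   remainder at most [1/c]; the digits of a vanishing combination at [c] must
   therefore cancel once [c] exceeds the coefficients. *)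
Lemma comb_expansion (e : index -> R) (l : list (Z * index)) (c : nat) :
  (forall a n, (1 <= n)%nat ->
     inv_fact_sum (prefix_set a) n <= e a
     <= inv_fact_sum (prefix_set a) n + / (INR n * INR (fact n))) ->
  (1 <= c)%nat ->
  exists (N : Z) (r : R),
    INR (fact c) * comb e l = IZR (Z.of_nat c * N + digit_sum c l) + r /\
    INR c * Rabs r <= IZR (abs_sum l).
Proof.
  intros He Hc. induction l as [|[m a] l (N & r & IH & Hr)].
  - exists 0%Z, 0. simpl. rewrite Rabs_R0, Z.mul_0_r. simpl. lra.
  - destruct c as [|c]; [lia|].
    destruct (fact_inv_fact_sum_integer (prefix_set a) c) as [M HM].
    destruct (He a (S c) Hc) as [H1 H2].
    pose proof (INR_fact_lt_0 (S c)) as Hf.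
    assert (HSc : 0 < INR (S c)) by (apply lt_0_INR; lia).
    (* The tail of [e a] after the digit at [S c], scaled by [(S c)!]; the terms before this digit
       contribute the multiple [S c * M]. *)
    set (rho := INR (fact (S c)) * (e a - inv_fact_sum (prefix_set a) (S c))).
    assert (Hrho : 0 <= rho /\ INR (S c) * rho <= 1).
    { unfold rho. split; [apply Rmult_le_pos; lra|].
      assert (E : INR (S c) * (INR (fact (S c)) * / (INR (S c) * INR (fact (S c)))) = 1)
        by (field; lra).
      rewrite <- E. apply Rmult_le_compat_l; [lra|]. apply Rmult_le_compat_l; lra. }
    exists (N + m * M)%Z, (r + IZR m * rho). split.
    + assert (E : INR (fact (S c)) * e a
                  = INR (S c) * IZR M + IZR (Z.b2z (prefix_set a (S c))) + rho).
      { unfold rho. rewrite <- HM. cbn [inv_fact_sum].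
        replace (IZR (Z.b2z (prefix_set a (S c))))
          with (INR (Nat.b2n (prefix_set a (S c))))
          by (destruct (prefix_set a (S c)); reflexivity).
        set (b := INR (Nat.b2n (prefix_set a (S c)))).
        change (fact (S c)) with (S c * fact c)%nat. rewrite mult_INR.
        field. split; [apply INR_fact_neq_0|lra]. }
      change (comb e ((m, a) :: l)) with (IZR m * e a + comb e l).
      change (digit_sum (S c) ((m, a) :: l))
        with (m * Z.b2z (prefix_set a (S c)) + digit_sum (S c) l)%Z.
      rewrite Rmult_plus_distr_l, IH.
      replace (INR (fact (S c)) * (IZR m * e a))
        with (IZR m * (INR (fact (S c)) * e a)) by ring.
      rewrite E, INR_IZR_INZ.
      rewrite !plus_IZR, !mult_IZR, !plus_IZR, !mult_IZR. ring.
    + change (abs_sum ((m, a) :: l)) with (Z.abs m + abs_sum l)%Z.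
      rewrite plus_IZR, abs_IZR.
      assert (Rabs (r + IZR m * rho) <= Rabs r + Rabs (IZR m) * rho).
      { rewrite <- (Rabs_pos_eq rho) at 2 by lra. rewrite <- Rabs_mult. apply Rabs_triang. }
      pose proof (Rabs_pos (IZR m)). nra.
Qed.

Lemma digit_sum_bound (c : nat) (l : list (Z * index)) :
  (Z.abs (digit_sum c l) <= abs_sum l)%Z.
Proof.
  induction l as [|[m a] l IH]; simpl; [lia|].
  destruct (prefix_set a c); simpl; lia.
Qed.

(** At the codes of long prefixes of [b], only the occurrences of [b] itself have digit [1]. *)
Lemma digit_sum_eventually (b : index) (l : list (Z * index)) :
  exists K, forall k, (K <= k)%nat -> digit_sum (prefix_code b k) l = total_coef b l.
Proof.
  induction l as [|[m a] l [K IH]]; [now exists 0%nat|].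
  destruct (prefix_set_almost_disjoint a b) as [K' H].
  exists (Nat.max K K'). intros k Hk. simpl. rewrite IH, H by lia. reflexivity.
Qed.

Lemma rationally_independent_family :
  exists e : index -> R, forall l, comb e l = 0 -> forall b, total_coef b l = 0%Z.
Proof.
  destruct (boolp.choice (fun a : index => inv_fact_series (prefix_set a))) as [e He].
  exists e. intros l Hl b.
  destruct (digit_sum_eventually b l) as [K HK].
  (* Large enough for the digit sum to equal [total_coef b l] and for the code [c > k] to exceed
     [abs_sum l]. *)
  set (k := Nat.max K (Z.to_nat (abs_sum l))).
  rewrite <- (HK k) by (unfold k; lia).
  pose proof (prefix_code_gt b k) as Hck. set (c := prefix_code b k) in *.
  assert (Hc : (abs_sum l < Z.of_nat c)%Z) by (unfold k in Hck; lia).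
  destruct (comb_expansion e l c He) as (N & r & E & Hr); [lia|].
  rewrite Hl, Rmult_0_r in E.
  apply IZR_lt in Hc. rewrite <- INR_IZR_INZ in Hc.
  assert (0 < INR c) by (apply lt_0_INR; lia).
  assert (Hr1 : Rabs r < 1) by nra.
  apply Rabs_def2 in Hr1.
  (* This integer is [- r], of absolute value below [1]. The digit sum is thus a multiple of [c]
     smaller than [c] in absolute value, hence [0]. *)
  assert (HZ : (Z.of_nat c * N + digit_sum c l = 0)%Z).
  { assert (IZR (Z.of_nat c * N + digit_sum c l) < 1) as L1 by lra.
    assert (-1 < IZR (Z.of_nat c * N + digit_sum c l)) as L2 by lra.
    apply lt_IZR in L1, L2. lia. }
  pose proof (digit_sum_bound c l).
  assert (abs_sum l < Z.of_nat c)%Z by (apply lt_IZR; now rewrite <- INR_IZR_INZ).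
  assert (N = 0)%Z by nia. nia.
Qed.

(** Rational independence makes the span of the pairs [(e a, w a)] the graph of a partial linear
    function, which then extends to the line. *)
Lemma additive_interpolation :
  exists e : index -> R, forall w : index -> R,
    exists phi, additive phi /\ forall a, phi (e a) = w a.
Proof.
  destruct rationally_independent_family as [e He]. exists e. intros w.
  (* [D] is a common denominator of the rational coefficients. *)
  pose (W := fun p : R2 => exists (D : Z) l, D <> 0%Z /\
               IZR D * fst p = comb e l /\ IZR D * snd p = comb w l).
  destruct (additive_extension (fun _ => True) W) as (phi & Hphi & ext & _).
  - split; [| |trivial].
    + intros q u v u' v' (p & d & Hd & ->) (D & l & HD & Hu & Hv) (D' & l' & HD' & Hu' & Hv').
      simpl in *.
      exists (D * D' * d)%Z, (map (fun t => (D' * d * fst t, snd t)%Z) l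
                              ++ map (fun t => (D * p * fst t, snd t)%Z) l').
      split; [nia|]. simpl. rewrite !comb_app, !comb_scale.
      rewrite <- Hu, <- Hv, <- Hu', <- Hv', !mult_IZR.
      apply not_0_IZR in Hd. split; now field.
    + intros v (D & l & HD & Hu & Hv). simpl in *.
      rewrite Rmult_0_r in Hu. symmetry in Hu.
      rewrite (comb_total_coef_0 w l (He l Hu)) in Hv.
      apply not_0_IZR in HD.
      destruct (Rmult_integral _ _ Hv); tauto.
  - exists 1%Z, nil. simpl. split; [lia|lra].
  - exists phi. split; [assumption|]. intros a. apply ext.
    exists 1%Z, ((1%Z, a) :: nil). simpl. split; [lia|split; ring].
Qed.

(** * A totally disconnected example *)

(** The identity of the rationals, extended with rational values. *)
Lemma rational_valued_additive :
  exists phi, additive phi /\ phi 1 = 1 /\ forall x, rational (phi x).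
Proof.
  destruct (additive_extension rational (fun p => rational (fst p) /\ fst p = snd p))
    as (phi & Hphi & ext & Hrat).
  - split; simpl.
    + intros q u v u' v' Hq [Hu <-] [Hu' <-]. split; [|reflexivity].
      apply rational_plus; [assumption|]. now apply rational_mult.
    + intros v [_ <-]. reflexivity.
    + intros u v [Hu <-]. assumption.
  - simpl. split; [apply (rational_IZR 0)|reflexivity].
  - exists phi. split; [assumption|]. split; [|assumption].
    apply ext. simpl. split; [apply (rational_IZR 1)|reflexivity].
Qed.

Lemma rational_valued_not_continuous (g : R -> R) :
  (forall x, rational (g x)) -> g 0 = 0 -> g 1 = 1 -> ~ continuity g.
Proof.
  intros Hrat g0 g1 Hc. destruct irrational_between_0_1 as (s & Hs & Hs01).
  destruct (IVT (fun x => g x - s) 0 1) as (z & _ & Hz).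
  - apply (continuity_minus g (fun _ => s)); [assumption|].
    apply continuity_const. intros x y. reflexivity.
  - lra.
  - rewrite g0. lra.
  - rewrite g1. lra.
  - apply Hs. replace s with (g z) by lra. apply Hrat.
Qed.

Lemma open2_below (s : R) : open2 (fun p => snd p < s).
Proof.
  apply open2_boxP. intros x y Hy. simpl in Hy. exists (s - y). split; [lra|].
  intros x' y' _ H. apply Rabs_def2 in H. simpl. lra.
Qed.

Lemma open2_above (s : R) : open2 (fun p => s < snd p).
Proof.
  apply open2_boxP. intros x y Hy. simpl in Hy. exists (y - s). split; [lra|].
  intros x' y' _ H. apply Rabs_def2 in H. simpl. lra.
Qed.

(** A horizontal line at an irrational height between [g 0] and [g 1] misses the graph and separates
    it. *)
Lemma rational_valued_graph_not_connected (g : R -> R) :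
  (forall x, rational (g x)) -> g 0 = 0 -> g 1 = 1 -> ~ connected2 (graph g).
Proof.
  intros Hrat g0 g1 Hc. destruct irrational_between_0_1 as (s & Hs & Hs01).
  apply Hc. exists (fun p => snd p < s), (fun p => s < snd p).
  split; [apply open2_below|]. split; [apply open2_above|].
  split; [|split; [|split]].
  - intros [x y] Hxy. unfold graph in Hxy; simpl in *. subst y.
    destruct (Rtotal_order (g x) s) as [H|[H|H]]; [tauto| |tauto].
    exfalso. apply Hs. rewrite <- H. apply Hrat.
  - exists (0, g 0). unfold graph; simpl. split; [reflexivity|lra].
  - exists (1, g 1). unfold graph; simpl. split; [reflexivity|lra].
  - intros p _. simpl. lra.
Qed.

Lemma exists_totally_disconnected_monomial (n : nat) : (1 <= n)%nat ->
  exists g, monomial n g /\ ~ continuity g /\ totally_disconnected2 (graph g).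
Proof.
  intros Hn. destruct rational_valued_additive as (phi & Hphi & phi1 & Hrat).
  assert (Hm := monomial_pow_additive phi n Hphi).
  assert (Hrat' : forall x, rational (phi x ^ n)).
  { intros x. apply rational_pow, Hrat. }
  assert (g0 := monomial_0 n _ Hn Hm). simpl in g0.
  assert (g1 : phi 1 ^ n = 1) by (rewrite phi1; apply pow1).
  exists (fun x => phi x ^ n). split; [assumption|]. split.
  - now apply rational_valued_not_continuous.
  - destruct (monomial_graph_dichotomy n _ Hn Hm) as [H|H]; [|assumption].
    exfalso. revert H. now apply rational_valued_graph_not_connected.
Qed.

(** * A connected example *)

(* The box of index [n = <m, <<i1, i2>, <j1, j2>>>] has centre
   [((i1 - i2)/m, (j1 - j2)/m)] and radius [2/m]. *)
Definition box (n : nat) (p : R2) : Prop :=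
  let (m, ij) := Cantor.of_nat n in
  let (i, j) := Cantor.of_nat ij in
  let (i1, i2) := Cantor.of_nat i in
  let (j1, j2) := Cantor.of_nat j in
  Rabs (INR m * fst p - (INR i1 - INR i2)) < 2 /\
  Rabs (INR m * snd p - (INR j1 - INR j2)) < 2.

Lemma near_integer (t : R) :
  exists i1 i2 : nat, Rabs (t - (INR i1 - INR i2)) <= 1.
Proof.
  destruct (archimed t) as [H1 H2].
  (* [Z.to_nat] truncates at [0], so at least one of the two numbers vanishes and their difference
     is [up t]. *)
  exists (Z.to_nat (up t)), (Z.to_nat (- up t)).
  replace (INR (Z.to_nat (up t)) - INR (Z.to_nat (- up t))) with (IZR (up t)).
  - apply Rabs_le. lra.
  - rewrite !INR_IZR_INZ, <- minus_IZR. f_equal. lia.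
Qed.

Lemma box_basis (U : R2 -> Prop) (p : R2) :
  open2 U -> U p -> exists n, box n p /\ forall q, box n q -> U q.
Proof.
  destruct p as [x y]. rewrite open2_boxP. intros HU Hp.
  destruct (HU _ _ Hp) as (eps & Heps & H).
  (* After scaling by [m], [p] is within [1] of the centre and every point of the box within [2],
     whence the [3]. *)
  destruct (exists_large_nat (3 / eps)) as [N HN].
  set (m := S N) in *.
  assert (Hm : 0 < INR m) by (apply lt_0_INR; unfold m; lia).
  assert (Hm3 : 3 < INR m * eps).
  { apply (Rmult_lt_compat_r eps) in HN; [|exact Heps].
    replace (3 / eps * eps) with 3 in HN by (field; lra). exact HN. }
  destruct (near_integer (INR m * x)) as (i1 & i2 & Hi).
  destruct (near_integer (INR m * y)) as (j1 & j2 & Hj).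
  exists (Cantor.to_nat (m, Cantor.to_nat (Cantor.to_nat (i1, i2), Cantor.to_nat (j1, j2)))).
  unfold box. rewrite !Cantor.cancel_of_to. simpl fst; simpl snd.
  split; [lra|]. intros [x' y']. simpl fst; simpl snd. intros [Hx' Hy'].
  assert (K : forall t t' c, Rabs (INR m * t - c) <= 1 -> Rabs (INR m * t' - c) < 2 ->
                Rabs (t' - t) < eps).
  { intros t t' c Ht Ht'. apply (Rmult_lt_reg_l (INR m)); [exact Hm|].
    rewrite <- (Rabs_pos_eq (INR m)) at 1 by lra. rewrite <- Rabs_mult.
    replace (INR m * (t' - t)) with (INR m * t' - c + - (INR m * t - c)) by ring.
    apply Rle_lt_trans with (1 := Rabs_triang _ _). rewrite Rabs_Ropp. lra. }
  apply H; eapply K; eassumption.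
Qed.

(** A graph through such a point cannot be separated by [U] and [V]. *)
Definition unseparated (U V : R2 -> Prop) (p : R2) : Prop :=
  (U p /\ V p) \/ (~ U p /\ ~ V p).

(** Every sequence yields a set, and every open set arises from the sequence that selects the boxes
    inside it. *)
Definition decode (s : nat -> bool) (p : R2) : Prop := exists n, s n = true /\ box n p.

Lemma decode_open (U : R2 -> Prop) (s : nat -> bool) : open2 U ->
  (forall n, s n = true <-> forall q, box n q -> U q) ->
  forall p, decode s p <-> U p.
Proof.
  intros HU Hs p. split.
  - intros (n & Hn & Hp). now apply (proj1 (Hs n) Hn).
  - intros Up. destruct (box_basis U p HU Up) as (n & Hp & Hn).
    exists n. split; [now apply Hs|assumption].
Qed.

Lemma additive_rational (phi : R -> R) (r x : R) :
  additive phi -> rational r -> phi (r * x) = r * phi x.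
Proof.
  intros Hphi Hr.
  assert (Hm : monomial 1 phi).
  { intros y h. simpl. unfold Delta. rewrite Hphi. field. }
  rewrite (monomial_rational 1 phi r x Hm Hr). ring.
Qed.

(* The index [a] encodes a pair of open sets when [a 0 = true]; the indices with
   [a 0 = false] are kept free to make [phi] nonlinear. *)
Lemma additive_meeting_unseparated :
  exists phi, additive phi /\
    (exists x, x <> 0 /\ phi x = 0) /\ (exists x, phi x = 1) /\
    forall U V l r, open2 U -> open2 V -> l < r ->
      (forall x, l < x < r -> exists y, unseparated U V (x, y)) ->
      exists x, unseparated U V (x, phi x).
Proof.
  destruct additive_interpolation as [e He].
  assert (e0 : forall a, e a <> 0).
  { intros a Ha. destruct (He (fun _ => 1)) as (phi & Hphi & H).
    generalize (H a). rewrite Ha, (additive_0 phi Hphi). lra. }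
  pose (Ua := fun a : index => decode (fun n => a (2 * n + 1)%nat)).
  pose (Va := fun a : index => decode (fun n => a (2 * n + 2)%nat)).
  assert (val : forall a : index, exists v,
            (a 0%nat = false -> v = INR (Nat.b2n (a 1%nat))) /\
            (a 0%nat = true -> forall l r, l < r ->
               (forall x, l < x < r -> exists y, unseparated (Ua a) (Va a) (x, y)) ->
               exists q, rational q /\ unseparated (Ua a) (Va a) (q * e a, q * v))).
  { intros a. destruct (a 0%nat).
    2:{ eexists. split; [reflexivity|discriminate]. }
    destruct (classic (exists l r, l < r /\ forall x, l < x < r ->
                exists y, unseparated (Ua a) (Va a) (x, y))) as [(l & r & Hlr & H)|H].
    (* Some [q e a] lies in [(l, r)], and the value [y / q] at [e a] forces [phi] through the
       unseparated point [(q e a, y)]. *)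
    - destruct (rational_multiple_dense (e a) l r (e0 a) Hlr) as (q & Hq & Hq0 & Hqe).
      destruct (H _ Hqe) as [y Hy]. exists (/ q * y). split; [discriminate|].
      (* The conclusion does not mention the interval, so the point found over one interval serves
         for all of them. *)
      intros _ l' r' _ _. exists q. split; [assumption|].
      now replace (q * (/ q * y)) with y by now field.
    - exists 0. split; [discriminate|]. intros _ l r Hlr Hy. exfalso. apply H.
      now exists l, r. }
  destruct (boolp.choice val) as [w Hw].
  destruct (He w) as (phi & Hphi & Hphie).
  exists phi. split; [assumption|]. split; [|split].
  (* When [a 0 = false], the value at [e a] is the bit [a 1], which supplies a zero of [phi] and a
     point with value [1]. *)
  - exists (e (fun _ => false)). split; [apply e0|].
    rewrite Hphie. now rewrite (proj1 (Hw (fun _ => false)) eq_refl).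
  - exists (e (fun k => Nat.eqb k 1)).
    rewrite Hphie. now rewrite (proj1 (Hw (fun k => Nat.eqb k 1)) eq_refl).
  - intros U V l r HU HV Hlr Huns.
    (* Position [0] is the flag; odd positions list the boxes inside [U], positive even ones those
       inside [V]. *)
    pose (a := fun k => decide (k = 0%nat \/
            (exists n, k = (2 * n + 1)%nat /\ forall q, box n q -> U q) \/
            (exists n, k = (2 * n + 2)%nat /\ forall q, box n q -> V q))).
    assert (a0 : a 0%nat = true) by (apply decideP; now left).
    assert (HUa : forall p, Ua a p <-> U p).
    { apply decode_open; [assumption|]. intros n. unfold a. rewrite decideP. split.
      - intros [H|[(k & Hk & H)|(k & Hk & H)]]; [lia| |lia].
        now replace n with k by lia.
      - intros H. right; left. now exists n. }
    assert (HVa : forall p, Va a p <-> V p).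
    { apply decode_open; [assumption|]. intros n. unfold a. rewrite decideP. split.
      - intros [H|[(k & Hk & H)|(k & Hk & H)]]; [lia|lia|].
        now replace n with k by lia.
      - intros H. right; right. now exists n. }
    assert (E : forall p, unseparated (Ua a) (Va a) p <-> unseparated U V p).
    { intros p. unfold unseparated. rewrite HUa, HVa. tauto. }
    destruct (proj2 (Hw a) a0 l r Hlr) as (q & Hq & H).
    { intros x Hx. destruct (Huns x Hx) as [y Hy]. exists y. now apply E. }
    exists (q * e a). rewrite (additive_rational phi q _ Hphi Hq), Hphie. now apply E.
Qed.

Lemma open2_projection (U : R2 -> Prop) (x : R) :
  open2 U -> (exists y, U (x, y)) ->
  exists eps, 0 < eps /\ forall x', Rabs (x' - x) < eps -> exists y, U (x', y).
Proof.
  rewrite open2_boxP. intros HU [y Hy]. destruct (HU _ _ Hy) as (eps & Heps & H).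
  exists eps. split; [assumption|]. intros x' Hx'. exists y. apply H; [assumption|].
  now rewrite Rminus_diag, Rabs_R0.
Qed.

(** Otherwise [U] and [V] would split the vertical line, which is connected, into two disjoint
    nonempty open parts. *)
Lemma vertical_line_unseparated (U V : R2 -> Prop) (x : R) :
  open2 U -> open2 V -> (exists y, U (x, y)) -> (exists y, V (x, y)) ->
  exists y, unseparated U V (x, y).
Proof.
  rewrite !open2_boxP. intros HU HV [y1 H1] [y2 H2].
  apply NNPP. intros Hno.
  assert (sep : forall y, V (x, y) <-> ~ U (x, y)).
  { intros y. unfold unseparated in Hno. split.
    - intros Hv Hu. apply Hno. exists y. tauto.
    - intros Hu. apply NNPP. intros Hv. apply Hno. exists y. tauto. }
  apply (proj1 (sep y2) H2).
  apply (locally_constant_R (fun y => U (x, y))) with (a := y1); [|assumption].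
  assert (x0 : forall eps, 0 < eps -> Rabs (x - x) < eps)
    by (intros; now rewrite Rminus_diag, Rabs_R0).
  intros y. destruct (classic (U (x, y))) as [Hu|Hu].
  - destruct (HU _ _ Hu) as (eps & Heps & H). exists eps. split; [assumption|].
    intros y' Hy'. split; [tauto|]. intros _. now apply H; [apply x0|].
  - destruct (HV _ _ (proj2 (sep y) Hu)) as (eps & Heps & H).
    exists eps. split; [assumption|]. intros y' Hy'. split; [|tauto].
    intros Hu'. exfalso. apply (proj1 (sep y')); [now apply H; [apply x0|]|assumption].
Qed.

(** The projections of separating sets [U], [V] to the first axis are open and cover it, so they
    overlap on an interval. Each vertical line over it has an unseparated point, and by hypothesis
    some unseparated point lies on the graph. *)
Lemma graph_connected_of_meeting_unseparated (phi : R -> R) :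
  (forall U V l r, open2 U -> open2 V -> l < r ->
     (forall x, l < x < r -> exists y, unseparated U V (x, y)) ->
     exists x, unseparated U V (x, phi x)) ->
  connected2 (graph phi).
Proof.
  intros Hphi (U & V & HU & HV & Hcov & [[xu yu] [_ Hu]] & [[xv yv] [_ Hv]] & Hdisj).
  pose (A := fun x => exists y, U (x, y)). pose (B := fun x => exists y, V (x, y)).
  assert (AB : forall x, A x \/ B x).
  { intros x. destruct (Hcov (x, phi x) eq_refl); [left|right]; now exists (phi x). }
  assert (Hx : exists x, A x /\ B x).
  { apply NNPP. intros Hno.
    assert (sep : forall x, A x -> B x -> False)
      by (intros x Ax Bx; apply Hno; now exists x).
    assert (A xv).
    { apply (locally_constant_R A) with (a := xu); [|now exists yu].
      intros x. destruct (AB x) as [Ax|Bx].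
      - destruct (open2_projection U x HU Ax) as (eps & Heps & H).
        exists eps. split; [assumption|]. intros x' Hx'. split; [tauto|].
        intros _. now apply H.
      - destruct (open2_projection V x HV Bx) as (eps & Heps & H).
        exists eps. split; [assumption|]. intros x' Hx'. split.
        + intros Ax'. exfalso. apply (sep x' Ax'). now apply H.
        + intros Ax. exfalso. now apply (sep x). }
    apply (sep xv); [assumption|now exists yv]. }
  destruct Hx as (x & Ax & Bx).
  destruct (open2_projection U x HU Ax) as (e1 & He1 & H1).
  destruct (open2_projection V x HV Bx) as (e2 & He2 & H2).
  pose proof (Rmin_l e1 e2). pose proof (Rmin_r e1 e2).
  pose proof (Rmin_pos e1 e2 He1 He2) as He. set (e := Rmin e1 e2) in *.
  destruct (Hphi U V (x - e) (x + e) HU HV) as [z Hz]; [lra| |].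
  - intros x' Hx'. apply vertical_line_unseparated; try assumption.
    + apply H1. apply Rabs_def1; lra.
    + apply H2. apply Rabs_def1; lra.
  - destruct Hz as [[Uz Vz]|[Uz Vz]].
    + exact (Hdisj (z, phi z) eq_refl Uz Vz).
    + destruct (Hcov (z, phi z) eq_refl); tauto.
Qed.

(** The new graph is the image of the old one under the continuous map [(x, y) |-> (x, psi y)]. *)
Lemma graph_connected_comp (phi psi : R -> R) :
  continuity psi -> connected2 (graph phi) -> connected2 (graph (fun x => psi (phi x))).
Proof.
  intros Hpsi Hphi (U & V & HU & HV & Hcov & [[xu yu] [Gu Hu]] & [[xv yv] [Gv Hv]] & Hdisj).
  unfold graph in Gu, Gv; simpl in Gu, Gv. subst yu yv.
  assert (pull : forall O, open2 O -> open2 (fun p => O (fst p, psi (snd p)))).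
  { intros O. rewrite !open2_boxP. intros HO x y Hxy. simpl in Hxy.
    destruct (HO _ _ Hxy) as (eps & Heps & H).
    destruct (Hpsi y eps Heps) as (d & Hd & Hlim).
    exists (Rmin eps d). split; [now apply Rmin_pos|].
    intros x' y' Hx' Hy'. simpl. apply H.
    - apply Rlt_le_trans with (1 := Hx'), Rmin_l.
    (* The limit defining [continuity] excludes the point [y] itself, so equality is a separate
       case. *)
    - destruct (Req_dec y y') as [<-|Hyy']; [now rewrite Rminus_diag, Rabs_R0|].
      apply Hlim. split; [now split|]. apply Rlt_le_trans with (1 := Hy'), Rmin_r. }
  apply Hphi.
  exists (fun p => U (fst p, psi (snd p))), (fun p => V (fst p, psi (snd p))).
  assert (G : forall p, graph phi p -> graph (fun x => psi (phi x)) (fst p, psi (snd p))).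
  { intros p Gp. unfold graph in *. simpl. now rewrite Gp. }
  split; [now apply pull|]. split; [now apply pull|].
  split; [intros p Gp; now apply Hcov, G|].
  split; [now exists (xu, phi xu)|]. split; [now exists (xv, phi xv)|].
  intros p Gp. now apply Hdisj, G.
Qed.

(** The rational multiples of [z] are dense, and a continuous [f] with [f x <> 0] has no zeros near
    [x]. *)
Lemma continuity_eq_0_of_rational_multiples (f : R -> R) (z : R) :
  z <> 0 -> continuity f -> (forall q, rational q -> f (q * z) = 0) ->
  forall x, f x = 0.
Proof.
  intros Hz Hc H0 x. apply NNPP. intros Hx.
  destruct (Hc x (Rabs (f x)) (Rabs_pos_lt _ Hx)) as (d & Hd & H).
  destruct (rational_multiple_dense z x (x + d) Hz) as (q & Hq & _ & Hqz); [lra|].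
  assert (Hlt : Rabs (f (q * z) - f x) < Rabs (f x)).
  { apply H. split; [split; [exact I|lra]|].
    change (Rabs (q * z - x) < d). apply Rabs_def1; lra. }
  rewrite (H0 q Hq), Rminus_0_l, Rabs_Ropp in Hlt. lra.
Qed.

Lemma exists_connected_monomial (n : nat) : (1 <= n)%nat ->
  exists f, monomial n f /\ ~ continuity f /\ connected2 (graph f).
Proof.
  intros Hn.
  destruct additive_meeting_unseparated as (phi & Hphi & (z & Hz & phiz) & (x1 & phix1) & Hmeet).
  exists (fun x => phi x ^ n). split; [now apply monomial_pow_additive|]. split.
  - intros Hc.
    (* [phi^n] vanishes at all rational multiples of [z], so continuity would make it zero
       everywhere, also at [x1]. *)
    assert (H := continuity_eq_0_of_rational_multiples _ z Hz Hc).
    cut (phi x1 ^ n = 0); [rewrite phix1, pow1; lra|]. apply H.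
    intros q Hq. rewrite (additive_rational phi q z Hphi Hq), phiz, Rmult_0_r.
    apply pow_i. lia.
  - apply (graph_connected_comp phi (fun y => y ^ n)).
    + apply derivable_continuous, derivable_pow.
    + now apply graph_connected_of_meeting_unseparated.
Qed.

Theorem theorem1 :
  (forall (n : nat) (f : R -> R), (1 <= n)%nat -> monomial n f ->
     connected2 (graph f) \/ totally_disconnected2 (graph f)) /\
  (forall n : nat, (1 <= n)%nat ->
     (exists f : R -> R, monomial n f /\ ~ continuity f /\ connected2 (graph f)) /\
     (exists g : R -> R, monomial n g /\ ~ continuity g /\ totally_disconnected2 (graph g))).
Proof.
  split; [exact monomial_graph_dichotomy|]. intros n Hn. split.
  - now apply exists_connected_monomial.
  - now apply exists_totally_disconnected_monomial.
Qed.
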